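(* Consider the compensating gossip algorithm with probabilistic quantizer $q_p$: at each time $t$, when the edge $(i,j)$ is selected, $$x_i(t+1)= x_i(t)-\tfrac12 q_p(x_i(t))+\tfrac12 q_p(x_j(t)),\qquad x_j(t+1)= x_j(t)-\tfrac12 q_p(x_j(t))+\tfrac12 q_p(x_i(t)),$$ and $x_h(t+1)=x_h(t)$ for $h\neq i,j$, starting from a given $x(0)\in\mathbb{R}^N$. Let $y(t)=\left(I-\frac1N\mathbf{1}\mathbf{1}^*\right)x(t)$ and $$J(W)=\limsup_{t\to\infty}\sqrt{\tfrac1N\,\mathbb{E}\left[\|y(t)\|^2\right]}.$$ Then, for every matrix $W$ of edge-selection probabilities, $J(W)\le\frac12$.
   Context: Let $\mathcal{G}=(\mathcal{V},\mathcal{E})$ be an undirected connected graph with node set $\mathcal{V}=\{1,\dots,N\}$, whose edges join distinct nodes. At each time $t\in\mathbb{Z}_{\ge0}$ one edge $(i,j)\in\mathcal{E}$ is randomly selected, with probability $W^{(i,j)}>0$, where $\sum_{(i,j)\in\mathcal{E}}W^{(i,j)}=1$; $W$ denotes the matrix with entries $W_{ij}=W^{(i,j)}$. Selections at different times are independent, and the edge selected at time $t$ is independent of $x(t)$ and of the quantization randomness. $\mathbf{1}$ is the all-ones vector, $\|\cdot\|$ the Euclidean norm. The expectation is over both the edge selection and the quantization. The probabilistic quantizer: for $x\in\mathbb{R}$, $q_p(x)$ is the random integer equal to $\lfloor x\rfloor$ with probability $\lceil x\rceil-x$ and to $\lceil x\rceil$ with probability $x-\lfloor x\rfloor$ (and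 $q_p(x)=x$ if $x\in\mathbb{Z}$). Standing independence assumption: for all $t\ge0$, given the values $x_i(t)$ for all $i\in\mathcal{V}$, the random variables $q_p(x_i(t))$, as $i$ varies, are independent; moreover, given the value $x_i(t)$ for any $i$, the random variable $q_p(x_i(t))$ is independent of $x_j(t)$ for every $j\ne i$. *)

(* Defs.v *)
From HB Require Import structures.
From mathcomp Require Import all_boot all_order all_algebra.
From mathcomp Require Import all_classical all_reals all_analysis.

Set Implicit Arguments.
Unset Strict Implicit.
Unset Printing Implicit Defensive.

Import Order.TTheory GRing.Theory Num.Theory.

Local Open Scope classical_set_scope.
Local Open Scope ring_scope.

(* Matrices carry the sup norm in the library, hence this definition. *)
Definition enorm (R : realType) (N : nat) (v : 'cV[R]_N) : R :=
  Num.sqrt (\sum_i v i 0 ^+ 2).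

Definition disagreement (R : realType) (N : nat) (x : 'cV[R]_N) : 'cV[R]_N :=
  let one : 'cV[R]_N := const_mx 1 in
  (1%:M - N%:R^-1 *: (one *m one^T)) *m x.

Definition connected_graph (N : nat) (adj : rel 'I_N) : Prop :=
  [/\ symmetric adj, irreflexive adj & forall i j, connect adj i j].

(* An undirected edge is the two-element set of its endpoints. *)
Definition edges (N : nat) (adj : rel 'I_N) : {set {set 'I_N}} :=
  [set [set ij.1; ij.2]%SET | ij : 'I_N * 'I_N & adj ij.1 ij.2]%SET.

(* W i j and W j i both denote the probability of the edge {i, j}; since an
   edge is counted once, the total runs over pairs i < j. *)
Definition selection_matrix (R : realType) (N : nat) (adj : rel 'I_N)
    (W : 'M[R]_N) : Prop :=
  [/\ forall i j, W i j = W j i,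
      forall i j, adj i j -> 0 < W i j,
      forall i j, ~~ adj i j -> W i j = 0 &
      \sum_(i < N) \sum_(j < N | (i < j)%N && adj i j) W i j = 1].

(* Probability that q_p x equals r; floor and ceiling coincide when x is an
   integer, and then the two generic weights both vanish. *)
Definition qp_law (R : realType) (x r : R) : R :=
  if x \is a Num.int then (r == x)%:R
  else if r == (Num.floor x)%:~R then (Num.ceil x)%:~R - x
  else if r == (Num.ceil x)%:~R then x - (Num.floor x)%:~R
  else 0.

Section Probability.
Context (d : measure_display) (T : measurableType d) (R : realType).
Variable P : probability T R.

Definition cond_prob (C A : set T) : R := fine (P (A `&` C)) / fine (P C).

(* All variables of the model take countably many values almost surely, so
   conditioning and independence are expressed on the events {Y = u}. *)
Definition indep_given (U V : Type) (C : set T) (Y : T -> U) (Z : T -> V) :=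
  forall u v,
    cond_prob C (Y @^-1` [set u] `&` Z @^-1` [set v]) =
    cond_prob C (Y @^-1` [set u]) * cond_prob C (Z @^-1` [set v]).

Definition mutual_indep_given (I : finType) (U : Type) (C : set T)
    (Y : I -> T -> U) :=
  forall (K : {set I}) (u : I -> U),
    cond_prob C (\bigcap_(i in [set` K]) Y i @^-1` [set u i]) =
    \prod_(i in K) cond_prob C (Y i @^-1` [set u i]).

Section Gossip.
Variables (N : nat) (adj : rel 'I_N) (W : 'M[R]_N) (x0 : 'cV[R]_N).

Definition vec (Y : 'I_N -> {RV P >-> R}) (w : T) : 'cV[R]_N :=
  \col_i Y i w.

(* X t i is x_i(t), Q t i is q_p(x_i(t)) and e t is the edge selected at
   time t. *)
Record compensating_gossip (e : nat -> T -> {set 'I_N})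
    (X Q : nat -> 'I_N -> {RV P >-> R}) : Prop := CompensatingGossip {
  edge_in : forall t w, e t w \in edges adj ;
  edge_measurable : forall t s, measurable (e t @^-1` [set s]) ;
  edge_law : forall t i j, adj i j ->
    P (e t @^-1` [set [set i; j]%SET]) = (W i j)%:E ;
  edge_indep : forall n,
    mutual_indep_given setT (fun t : 'I_n => e t) ;
  edge_indep_state : forall t,
    indep_given setT (e t) (fun w => (vec (X t) w, vec (Q t) w)) ;
  quantizer_law : forall t i a, let C := X t i @^-1` [set a] in
    P C != 0%E ->
    forall r, cond_prob C (Q t i @^-1` [set r]) = qp_law a r ;
  quantizer_mutual_indep : forall t v, let C := vec (X t) @^-1` [set v] in
    P C != 0%E -> mutual_indep_given C (fun i => Q t i : T -> R) ;
  (* row' i removes the i-th coordinate. *)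
  quantizer_indep_others : forall t i a, let C := X t i @^-1` [set a] in
    P C != 0%E -> indep_given C (Q t i) (fun w => row' i (vec (X t) w)) ;
  init : forall w, vec (X 0%N) w = x0 ;
  update : forall t w i j, i != j -> e t w = [set i; j]%SET ->
    [/\ X t.+1 i w = X t i w - 2^-1 * Q t i w + 2^-1 * Q t j w,
        X t.+1 j w = X t j w - 2^-1 * Q t j w + 2^-1 * Q t i w &
        forall h, h != i -> h != j -> X t.+1 h w = X t h w]
}.

Definition performance (X : nat -> 'I_N -> {RV P >-> R}) : \bar R :=
  limn_esup (fun t =>
    sqrte ((N%:R^-1)%:E *
      'E_P[(fun w => enorm (disagreement (vec (X t) w)) ^+ 2)%R])%E).

End Gossip.
End Probability.

(* Main.v *)
Require Import Defs.
From HB Require Import structures.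
From mathcomp Require Import all_boot all_order all_algebra.
From mathcomp Require Import all_classical all_reals all_analysis.
From mathcomp Require Import measurable_realfun ring lra.

Set Implicit Arguments.
Unset Strict Implicit.
Unset Printing Implicit Defensive.

Import Order.TTheory GRing.Theory Num.Theory.

Local Open Scope ring_scope.

(** The update reads [x(t+1) = x(t) - D_e q(t)], where [D_s] is the orthogonal
projection onto the zero-sum vectors supported on [s]. Write [q = x + n]: given
[x], the noise [n] is centered with independent coordinates of variance at most
[1/4]. With [Phi F = \sum_s w_s (1 - D_s) F (1 - D_s)], every positive
semidefinite [F] satisfies
  [E (x(t+1)^T F x(t+1)) <= E (x(t)^T (Phi F) x(t)) + (1/4) \sum_s w_s tr (D_s F D_s)],
and the last sum equals [tr F - tr (Phi F)] because [D_s] is idempotent.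
Starting from the projection [O] orthogonal to the all-ones vector, this
telescopes to [E |y(t)|^2 <= x(0)^T (Phi^t O) x(0) + N/4], whose first term
decays geometrically by a Poincare inequality on the connected graph. *)

(** * Quadratic forms and zero-sum projections *)

Section QuadraticForms.
Variables (R : realType) (N : nat).
Implicit Types (s : {set 'I_N}) (F M : 'M[R]_N) (v n : 'cV[R]_N).

Definition qform F v : R := (v^T *m F *m v) 0 0.

Definition psd F := forall v, 0 <= qform F v.

Lemma qformE F v : qform F v = \sum_k \sum_l F k l * (v k 0 * v l 0).
Proof.
rewrite /qform -mulmxA mxE; apply: eq_bigr => k _; rewrite !mxE big_distrr /=.
by apply: eq_bigr => l _; ring.
Qed.

Lemma qform_conj F M v : qform (M^T *m F *m M) v = qform F (M *m v).
Proof. by rewrite /qform trmx_mul !mulmxA. Qed.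

Lemma qformB F M v : qform (F - M) v = qform F v - qform M v.
Proof. by rewrite /qform mulmxBr mulmxBl !mxE. Qed.

Lemma qform_sum (I : finType) (w : I -> R) (G : I -> 'M[R]_N) v :
  qform (\sum_i w i *: G i) v = \sum_i w i * qform (G i) v.
Proof.
rewrite /qform mulmx_sumr mulmx_suml summxE; apply: eq_bigr => i _.
by rewrite -scalemxAr -scalemxAl mxE.
Qed.

Lemma qform_delta F k : qform F (delta_mx k 0) = F k k.
Proof.
rewrite /qform trmx_delta -rowE mxE (bigD1 k) //= !mxE !eqxx mulr1 big1 ?addr0 //.
by move=> l lk; rewrite !mxE (negbTE lk) mulr0.
Qed.

Lemma psd_trace_ge0 F : psd F -> 0 <= \tr F.
Proof. by move=> F0; apply: sumr_ge0 => k _; rewrite -qform_delta. Qed.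

(** Isolates the part linear in [n], written coordinatewise so that centered noise kills it, from
    the quadratic part, which only sees the covariance. Both cross terms are kept because [F] need
    not be symmetric. *)
Lemma qform_sub_mul F M v n :
  qform F (v - M *m n) = qform F v
    - (\sum_k ((v^T *m F *m M) 0 k + (M^T *m F *m v) k 0) * n k 0)
    + qform (M^T *m F *m M) n.
Proof.
rewrite qform_conj.
have -> : \sum_k ((v^T *m F *m M) 0 k + (M^T *m F *m v) k 0) * n k 0 =
    (v^T *m F *m (M *m n)) 0 0 + ((M *m n)^T *m F *m v) 0 0.
  have -> : v^T *m F *m (M *m n) = (v^T *m F *m M) *m n by rewrite !mulmxA.
  have -> : (M *m n)^T *m F *m v = n^T *m (M^T *m F *m v).
    by rewrite trmx_mul !mulmxA.
  rewrite [(_ *m n) 0 0]mxE [(n^T *m _) 0 0]mxE -big_split /=.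
  by apply: eq_bigr => k _; rewrite [n^T 0 k]mxE mulrDl [_ * n k 0 in X in _ + X]mulrC.
have entryB (A B : 'M[R]_1) : (A - B) 0 0 = A 0 0 - B 0 0 by rewrite !mxE.
by rewrite /qform [(v - _)^T]linearB /= !mulmxBl !mulmxBr !entryB; ring.
Qed.

(* The orthogonal projection onto the vectors supported on [s] with zero sum. *)
Definition centering s : 'M[R]_N :=
  \matrix_(k, l) ((k \in s)%:R * ((k == l)%:R - (l \in s)%:R / #|s|%:R)).

Lemma tr_centering s : (centering s)^T = centering s.
Proof.
apply/matrixP => k l; rewrite !mxE eq_sym.
have [->|_] := eqVneq k l => //; rewrite !sub0r !mulrN !mulrA.
by congr (- (_ / _)); rewrite mulrC.
Qed.

Lemma centering_mulE s v k :
  (centering s *m v) k 0 =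
  (k \in s)%:R * (v k 0 - (\sum_(l in s) v l 0) / #|s|%:R).
Proof.
rewrite mxE.
under eq_bigr do rewrite mxE -mulrA mulrBl.
rewrite -big_distrr sumrB /= (bigD1 k) //= eqxx mul1r big1 ?addr0; last first.
  by move=> l lk; rewrite eq_sym (negbTE lk) mul0r.
congr (_ * (_ - _)); rewrite big_distrl [RHS]big_mkcond /=; apply: eq_bigr => l _.
by case: (l \in s); rewrite ?mul0r ?mul1r // mulrC.
Qed.

(** The columns of [centering s] are supported on [s] and sum to zero, so the larger projection
    fixes them. The case [s' = s] is idempotence; the case of the full set lets the global
    projection absorb every edge projection. *)
Lemma centering_mul_subset s s' : s \subset s' ->
  centering s' *m centering s = centering s.
Proof.
move=> ss'; apply/matrixP => k l.
have -> : (centering s' *m centering s) k l =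
    (centering s' *m col l (centering s)) k 0.
  by rewrite !mxE; apply: eq_bigr => j _; rewrite [col l _ j 0]mxE.
have sum0 : \sum_(j in s') col l (centering s) j 0 = 0.
  under eq_bigr do rewrite !mxE.
  rewrite (bigID [in s]) /= [X in _ + X]big1 ?addr0; last first.
    by move=> j /andP[_ /negbTE ->]; rewrite mul0r.
  rewrite (eq_bigl [in s]) => [|j]; last first.
    by have /= := fintype.subsetP ss' j; case: (j \in s) => [->//|_]; rewrite andbF.
  under eq_bigr => j js do rewrite js mul1r.
  rewrite sumrB sumr_const -[_ *+ #|s|]mulr_natr.
  have [ls|ls] := boolP (l \in s); last first.
    rewrite !mul0r subr0 big1 // => j js.
    by case: eqP => // jl; rewrite jl (negbTE ls) in js.
  rewrite divfK ?pnatr_eq0; last by rewrite -lt0n; apply/card_gt0P; exists l.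
  rewrite (bigD1 l) //= eqxx big1 ?addr0 ?subrr // => j /andP[_ /negbTE -> //].
rewrite centering_mulE sum0 mul0r subr0 !mxE.
have := fintype.subsetP ss' k; case: (k \in s) => [->//|_]; first by rewrite mul1r.
by rewrite mul0r mulr0.
Qed.

Lemma qform_centering s v :
  qform (centering s) v = \sum_k (centering s *m v) k 0 ^+ 2.
Proof.
have {1}-> : centering s = (centering s)^T *m 1%:M *m centering s.
  by rewrite mulmx1 tr_centering centering_mul_subset.
rewrite qform_conj /qform mulmx1 mxE; apply: eq_bigr => k _.
by rewrite [_^T 0 k]mxE.
Qed.

Lemma psd_centering s : psd (centering s).
Proof.
by move=> v; rewrite qform_centering; apply: sumr_ge0 => k _; exact: sqr_ge0.
Qed.

Lemma qform_centering_pair i j v : i != j ->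
  qform (centering [set i; j]) v = (v i 0 - v j 0) ^+ 2 / 2.
Proof.
move=> ij; rewrite qform_centering.
under eq_bigr do rewrite centering_mulE.
rewrite (bigD1 i) // (bigD1 j) 1?eq_sym //=.
rewrite [X in _ + (_ + X)]big1 => [|k /andP[ki kj]]; last first.
  by rewrite !inE (negbTE ki) (negbTE kj) mul0r expr0n.
rewrite !inE !eqxx orbT /= cards2 ij big_setU1 ?inE //= big_set1.
by field.
Qed.

Lemma qform_centeringT_le v c :
  qform (centering [set: 'I_N]) v <= \sum_k (v k 0 - c) ^+ 2.
Proof.
rewrite qform_centering.
set m := (\sum_(l in [set: 'I_N]) v l 0) / #|[set: 'I_N]|%:R.
under eq_bigr do rewrite centering_mulE inE mul1r -/m.
have sum0 : \sum_k (v k 0 - m) = 0.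
  rewrite sumrB sumr_const -mulr_natr /m cardsT card_ord.
  rewrite [X in _ - X / _ * _](eq_bigl predT) => [|l]; last by rewrite inE.
  have [N0|N0] := eqVneq N 0%N; last by rewrite divfK ?subrr // pnatr_eq0.
  by rewrite big1 ?mul0r ?subr0 // => k; have := ltn_ord k; rewrite [X in (_ < X)%N]N0.
(* Subtracting a multiple of the zero sum of deviations from the mean [m] makes the inequality hold
   term by term, with slack [(m - c) ^+ 2]. *)
have -> : \sum_k (v k 0 - c) ^+ 2 =
    \sum_k ((v k 0 - c) ^+ 2 - 2 * (m - c) * (v k 0 - m)).
  by rewrite sumrB -big_distrr /= sum0 mulr0 subr0.
apply: ler_sum => k _.
have := sqr_ge0 (m - c); nra.
Qed.

Lemma trace_centeringT_le : \tr (centering [set: 'I_N]) <= N%:R.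
Proof.
rewrite -[N in leRHS]card_ord -sum1_card natr_sum; apply: ler_sum => k _.
by rewrite mxE !inE eqxx !mul1r lerBlDr lerDl invr_ge0 ler0n.
Qed.

(** * The averaged gossip step on quadratic forms *)

Section Averaging.
Variable w : {set 'I_N} -> R.
Hypothesis w_ge0 : forall s, 0 <= w s.
Hypothesis w_sum : \sum_s w s = 1.

(* The dual of the unquantized gossip update on second moments. *)
Definition gossip_dual F : 'M[R]_N :=
  \sum_s w s *: ((1%:M - centering s)^T *m F *m (1%:M - centering s)).

Lemma qform_gossip_dual F v :
  qform (gossip_dual F) v =
  \sum_s w s * qform F ((1%:M - centering s) *m v).
Proof.
by rewrite qform_sum; apply: eq_bigr => s _; rewrite qform_conj.
Qed.

Lemma psd_gossip_dual F : psd F -> psd (gossip_dual F).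
Proof.
by move=> F0 v; rewrite qform_gossip_dual; apply: sumr_ge0 => s _; exact: mulr_ge0.
Qed.

(** With D = [centering s], both D and 1 - D are symmetric and idempotent, so cyclicity of the trace
    gives tr ((1 - D) F (1 - D)) = tr (F (1 - D)) = tr F - tr (D F D). *)
Lemma trace_gossip_dual F :
  \tr F - \tr (gossip_dual F) =
  \sum_s w s * \tr ((centering s)^T *m F *m centering s).
Proof.
have {1}-> : \tr F = \sum_s w s * \tr F by rewrite -mulr_suml w_sum mul1r.
rewrite /gossip_dual [\tr (\sum_s _)]linear_sum -sumrB.
apply: eq_bigr => s _; rewrite linearZ /= -mulrBr; congr (_ * _).
have DD : centering s *m centering s = centering s.
  by rewrite centering_mul_subset.
have AA : (1%:M - centering s) *m (1%:M - centering s) = 1%:M - centering s.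
  by rewrite mulmxBl mul1mx mulmxBr mulmx1 DD subrr subr0.
rewrite [(1%:M - _)^T]linearB /= trmx1 tr_centering -!mulmxA.
rewrite [\tr ((1%:M - _) *m _)]mxtrace_mulC [\tr (centering s *m _)]mxtrace_mulC.
by rewrite -!mulmxA AA DD mulmxBr mulmx1 [\tr (F - _)]linearB /= subKr.
Qed.

(** The global projection O satisfies O D = D O = D for every D = [centering s], hence (1 - D) O (1
    - D) = O - D: one step loses exactly the Dirichlet form of the weighted graph. *)
Lemma qform_gossip_dual_centeringT v :
  qform (gossip_dual (centering [set: 'I_N])) v =
  qform (centering [set: 'I_N]) v - \sum_s w s * qform (centering s) v.
Proof.
have {1}-> : qform (centering [set: 'I_N]) v =
    \sum_s w s * qform (centering [set: 'I_N]) v.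
  by rewrite -mulr_suml w_sum mul1r.
rewrite qform_sum -sumrB.
apply: eq_bigr => s _; rewrite -mulrBr; congr (_ * _); rewrite -qformB.
set O := centering [set: 'I_N]; congr (qform _ v).
have OD : O *m centering s = centering s by rewrite centering_mul_subset ?subsetT.
have DO : centering s *m O = centering s.
  by rewrite -[LHS]trmxK trmx_mul !tr_centering OD tr_centering.
rewrite [(1%:M - _)^T]linearB /= trmx1 tr_centering mulmxBl mul1mx DO.
rewrite mulmxBr mulmx1 !mulmxBl.
by rewrite OD centering_mul_subset // subrr subr0.
Qed.

(** * Poincare inequality and geometric decay *)

Section Connected.
Variable adj : rel 'I_N.
Hypothesis adj_connected : connected_graph adj.
Hypothesis w_gt0 : forall i j, adj i j -> 0 < w [set i; j].

(** Induction along a path from [i] to [j]: each edge of the path contributes its own term to the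
    Dirichlet form, and the other terms are nonnegative. *)
Lemma poincare_pair i j : exists2 C : R, 0 <= C & forall v,
  (v i 0 - v j 0) ^+ 2 <= C * \sum_s w s * qform (centering s) v.
Proof.
have [_ adj_irr /(_ i j)/connectP[p]] := adj_connected.
elim: p i => [|k p IHp] i /=.
  by move=> _ ->; exists 0 => // v; rewrite subrr expr0n mul0r.
move=> /andP[ik pk] /(IHp _ pk)[C C0 CP] {IHp}.
have ik' : i != k by apply: contraTneq ik => ->; rewrite adj_irr.
have wik := w_gt0 ik.
(* The pair form is half the squared difference, so the first edge costs 2 / w; the bound (a + b)^2
   <= 2 a^2 + 2 b^2 doubles this cost and [C]. *)
exists (4 * (w [set i; k])^-1 + 2 * C) => [|v].
  by rewrite addr_ge0 // mulr_ge0 // invr_ge0 ltW.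
have {CP} := CP v; set E := \sum_s _ => CP.
have : (v i 0 - v k 0) ^+ 2 <= 2 * (w [set i; k])^-1 * E.
  rewrite -mulrA [leRHS]mulrC -ler_pdivrMr // ler_pdivlMl //.
  rewrite -qform_centering_pair // /E (bigD1 [set i; k]) //= lerDl.
  by apply: sumr_ge0 => s _; rewrite mulr_ge0 // psd_centering.
have := sqr_ge0 (v i 0 - v k 0 - (v k 0 - v j 0)).
lra.
Qed.

(** The deviation from the mean is at most that from the value at a fixed node [k0], to which the
    pairwise bounds apply; their constants add up. *)
Lemma poincare : exists2 C : R, 0 <= C & forall v,
  qform (centering [set: 'I_N]) v <= C * \sum_s w s * qform (centering s) v.
Proof.
have [N0|] := posnP N.
  exists 0 => // v; rewrite mul0r qform_centering big1 // => k _.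
  by have := ltn_ord k; rewrite [X in (_ < X)%N]N0.
case/prednK; set N' := N.-1 => NE.
pose k0 : 'I_N := cast_ord NE ord0.
pose C k := s2val (cid2 (poincare_pair k k0)).
exists (\sum_k C k) => [|v].
  by apply: sumr_ge0 => k _; rewrite /C; case: cid2.
apply: le_trans (qform_centeringT_le v (v k0 0)) _.
rewrite mulr_suml; apply: ler_sum => k _.
by rewrite /C; case: cid2 => /= c _ ->.
Qed.

Lemma gossip_dual_contraction : exists2 r : R, 0 <= r < 1 & forall t v,
  qform (iter t gossip_dual (centering [set: 'I_N])) v <=
  r ^+ t * qform (centering [set: 'I_N]) v.
Proof.
have [C C0 CP] := poincare.
have C1 : 0 < C + 1 by rewrite ltr_wpDl.
(* Using [C + 1] instead of [C] keeps the inverse meaningful when [C] is 0 and makes the rate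
   nonnegative. *)
exists (1 - (C + 1)^-1).
  rewrite subr_ge0 invf_le1 // lerDr C0 ltrBlDr ltrDl invr_gt0 //.
elim=> [|t IHt] v; first by rewrite expr0 mul1r.
set r := 1 - _ in IHt *.
have r0 : 0 <= r by rewrite subr_ge0 invf_le1 // lerDr.
rewrite iterS qform_gossip_dual.
(* The induction hypothesis is used at each averaged vector [(1%:M - centering s) *m v], leaving a
   single application of the dual to contract. *)
apply: le_trans (_ : r ^+ t * qform (gossip_dual (centering [set: 'I_N])) v <= _).
  rewrite qform_gossip_dual mulr_sumr; apply: ler_sum => s _.
  by rewrite mulrCA ler_wpM2l.
rewrite exprSr -mulrA ler_wpM2l ?exprn_ge0 // qform_gossip_dual_centeringT.
rewrite mulrBl mul1r lerB // ler_pdivrMl // (le_trans (CP v)) //.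
rewrite ler_wpM2r ?lerDl //; apply: sumr_ge0 => s _.
by rewrite mulr_ge0 // psd_centering.
Qed.

End Connected.
End Averaging.
End QuadraticForms.

(** * Moments of independent rounding noise *)

Section Rounding.
Variables (R : realType) (N : nat) (a : 'I_N -> R).
Implicit Types (eps : {ffun 'I_N -> bool}) (F M : 'M[R]_N) (v : 'cV[R]_N).

(** Product Bernoulli law; [eps k] records that coordinate [k] is rounded up. *)
Definition rounding_weight eps : R := \prod_k (if eps k then a k else 1 - a k).

Definition rounding_noise eps : 'cV[R]_N := \col_k ((eps k)%:R - a k).

Lemma sum_rounding_weight (h : 'I_N -> bool -> R) :
  \sum_eps rounding_weight eps * \prod_k h k (eps k) =
  \prod_k (a k * h k true + (1 - a k) * h k false).
Proof.
transitivity (\prod_k \sum_b (if b then a k else 1 - a k) * h k b).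
  rewrite bigA_distr_bigA; apply: eq_bigr => eps _.
  by rewrite /rounding_weight -big_split.
by apply: eq_bigr => k _; rewrite big_bool.
Qed.

Lemma rounding_weight_sum1 : \sum_eps rounding_weight eps = 1.
Proof.
have /= := sum_rounding_weight (fun _ _ => 1).
under eq_bigr do rewrite big1 // mulr1.
by move=> ->; rewrite big1 // => k _; ring.
Qed.

Lemma rounding_noise_mean k :
  \sum_eps rounding_weight eps * rounding_noise eps k 0 = 0.
Proof.
(* One coordinate of the noise is a product over all coordinates with factor 1 elsewhere, so its
   mean factorizes; the covariance below multiplies two such products. *)
pose h j (b : bool) := if j == k then b%:R - a j else 1.
have hE eps : \prod_j h j (eps j) = rounding_noise eps k 0.
  rewrite (bigD1 k) //= /h eqxx big1 ?mulr1 ?mxE // => j /negbTE -> //.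
under eq_bigr do rewrite -hE.
by rewrite sum_rounding_weight (bigD1 k) //= /h eqxx /=; ring.
Qed.

Lemma rounding_noise_cov k l :
  \sum_eps rounding_weight eps * (rounding_noise eps k 0 * rounding_noise eps l 0)
  = (k == l)%:R * (a k * (1 - a k)).
Proof.
pose h k j (b : bool) := if j == k then b%:R - a j else 1.
have hE i eps : \prod_j h i j (eps j) = rounding_noise eps i 0.
  rewrite (bigD1 i) //= /h eqxx big1 ?mulr1 ?mxE // => j /negbTE -> //.
under eq_bigr do rewrite -!hE -big_split /=.
rewrite (sum_rounding_weight (fun j b => h k j b * h l j b)) (bigD1 k) //= /h eqxx.
have [->|kl] := eqVneq k l; last by rewrite /=; ring.
rewrite big1 => [|j /negbTE ->]; last by ring.
by rewrite /=; ring.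
Qed.

Hypothesis a01 : forall k, 0 <= a k <= 1.

(** The linear term has mean zero and the covariance is diagonal, so only the diagonal of
    [M^T *m F *m M] remains. It is nonnegative, and each variance [a k * (1 - a k)] is at most
    1/4. *)
Lemma qform_rounding_noise F M v : psd F ->
  \sum_eps rounding_weight eps * qform F (v - M *m rounding_noise eps) <=
  qform F v + 4^-1 * \tr (M^T *m F *m M).
Proof.
move=> F0.
pose c k := (v^T *m F *m M) 0 k + (M^T *m F *m v) k 0.
pose H := M^T *m F *m M.
have mean0 : \sum_eps rounding_weight eps * \sum_k c k * rounding_noise eps k 0 = 0.
  under eq_bigr do rewrite mulr_sumr.
  rewrite exchange_big big1 //= => k _.
  under eq_bigr do rewrite mulrCA.
  by rewrite -mulr_sumr rounding_noise_mean mulr0.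
have cov : \sum_eps rounding_weight eps * qform H (rounding_noise eps) =
    \sum_k H k k * (a k * (1 - a k)).
  under eq_bigr do rewrite qformE mulr_sumr.
  rewrite exchange_big; apply: eq_bigr => k _ /=.
  under eq_bigr do rewrite mulr_sumr.
  rewrite exchange_big /= (bigD1 k) //= [X in _ + X]big1 ?addr0 => [|l lk].
    under eq_bigr do rewrite mulrCA.
    by rewrite -mulr_sumr rounding_noise_cov eqxx mul1r.
  under eq_bigr do rewrite mulrCA.
  by rewrite -mulr_sumr rounding_noise_cov eq_sym (negbTE lk) mul0r mulr0.
under eq_bigr do rewrite qform_sub_mul mulrDr mulrBr.
rewrite big_split sumrB -mulr_suml rounding_weight_sum1 mul1r mean0 subr0 cov.
rewrite lerD2l mulr_sumr; apply: ler_sum => k _.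
rewrite mulrC ler_wpM2r //; last by have := sqr_ge0 (a k - 2^-1); lra.
by rewrite -qform_delta qform_conj.
Qed.

End Rounding.

Local Open Scope classical_set_scope.

(** * Random variables with finitely supported laws *)

Section FiniteLaw.
Context (d : measure_display) (T : measurableType d) (R : realType).
Variable P : probability T R.

Definition point_mass (U : Type) (Y : T -> U) (u : U) : R :=
  fine (P (Y @^-1` [set u])).

Lemma probability_fineK (A : set T) : measurable A -> (fine (P A))%:E = P A.
Proof. by move=> mA; rewrite fineK ?fin_num_measure. Qed.

Section Support.
Variables (U : eqType) (Y : T -> U) (s : seq U).
Hypothesis mY : forall u, measurable (Y @^-1` [set u]).
Hypothesis s_uniq : uniq s.
Hypothesis s_full : \sum_(u <- s) point_mass Y u = 1.

(** The fibers over [s] are disjoint and have total mass 1, so the complement of their union is null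
    and contributes nothing. *)
Lemma integral_finite_law (f : T -> \bar R) :
  measurable_fun setT f -> (forall x, 0 <= f x)%E ->
  (\int[P]_x f x = \sum_(u <- s) \int[P]_(x in Y @^-1` [set u]) f x)%E.
Proof.
move=> mf f0.
pose D := \big[setU/set0]_(u <- s) (Y @^-1` [set u]).
have mD : measurable D by apply: bigsetU_measurable.
have tD : trivIset [set` s] (fun u => Y @^-1` [set u]).
  by move=> u v _ _ [x [/= -> ->]].
have decomp (g : T -> \bar R) : measurable_fun setT g -> (forall x, 0 <= g x)%E ->
    (\int[P]_(x in D) g x = \sum_(u <- s) \int[P]_(x in Y @^-1` [set u]) g x)%E.
  move=> mg g0; apply: ge0_integral_bigsetU => //.
  exact: measurable_funTS.
have PD : P D = 1%E.
  have := decomp (cst 1%E) (measurable_cst _) (fun=> lee01).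
  rewrite integral_cst // mul1e => ->.
  transitivity (\sum_(u <- s) (point_mass Y u)%:E)%E.
    apply: eq_bigr => u _.
    by rewrite [LHS]integral_cst // [LHS]mul1e [RHS]probability_fineK.
  by rewrite sumEFin s_full.
rewrite -decomp // -[in LHS](setUv D) ge0_integral_setU //; first last.
- by apply/disj_setPCl.
- by rewrite setUv.
- exact: measurableC.
rewrite [X in (_ + X)%E]null_set_integral ?adde0 //.
- exact: measurableC.
- exact: measurable_funTS.
- by rewrite [LHS]probability_setC // PD subee.
Qed.

Lemma probability_finite_law (B : set T) : measurable B ->
  fine (P B) = \sum_(u <- s) fine (P (B `&` Y @^-1` [set u])).
Proof.
move=> mB; apply: EFin_inj; rewrite probability_fineK // -sumEFin.
rewrite -[in LHS](setIT B) -integral_indic // integral_finite_law //; last first.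
  exact/measurable_EFinP/measurable_indic.
apply: eq_bigr => u _; rewrite integral_indic // probability_fineK //.
exact: measurableI.
Qed.

Section Image.
Variables (V : eqType) (Z : T -> V) (F : U -> V).
Hypothesis mZ : forall z, measurable (Z @^-1` [set z]).
Hypothesis ZE : forall x, Z x = F (Y x).

(** Change of variables for [Z], a function of [Y]. Several points of [s] may share an image;
    [undup] merges them and their masses add. *)
Lemma sum_point_mass_image (g : V -> R) :
  \sum_(z <- undup (map F s)) point_mass Z z * g z =
  \sum_(u <- s) point_mass Y u * g (F u).
Proof.
have massE z : point_mass Z z = \sum_(u <- s | F u == z) point_mass Y u.
  rewrite /point_mass probability_finite_law // [RHS]big_mkcond.
  apply: eq_bigr => u _; case: eqP => Fuz.
    congr (fine (P _)).
    by apply/seteqP; split => [x []//|x /= Yu]; split=> //=; rewrite ZE Yu.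
  rewrite (_ : _ `&` _ = set0) ?measure0 //; apply/seteqP; split => // x [/=].
  by rewrite ZE => + Yu; rewrite Yu.
under eq_bigr do rewrite massE mulr_suml.
rewrite (exchange_big_dep predT) //= [LHS]big_seq [RHS]big_seq.
apply: eq_bigr => u us; rewrite -[RHS]mulr1.
under eq_bigl do rewrite eq_sym.
rewrite -big_filter filter_pred1_uniq ?undup_uniq ?big_seq1 ?mulr1 //.
by rewrite mem_undup map_f.
Qed.

Lemma image_finite_law : \sum_(z <- undup (map F s)) point_mass Z z = 1.
Proof.
rewrite -s_full; have := sum_point_mass_image (fun=> 1).
by under eq_bigr do rewrite mulr1; under [in RHS]eq_bigr do rewrite mulr1.
Qed.

End Image.
End Support.
End FiniteLaw.

(** * The quantizer as a Bernoulli rounding *)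

Section Quantizer.
Variable R : realType.

Definition frac_part (x : R) : R := x - (Num.floor x)%:~R.

Lemma frac_part_itv x : 0 <= frac_part x <= 1.
Proof.
have := floor_itv x; rewrite intrD /frac_part => /andP[]; lra.
Qed.

(* [x + (b - frac_part x)] is [floor x + b]; the integer case is covered because
   [b = true] then has weight 0. *)
Lemma qp_law_round x (b : bool) :
  qp_law x (x + (b%:R - frac_part x)) =
  if b then frac_part x else 1 - frac_part x.
Proof.
have -> : x + (b%:R - frac_part x) = (Num.floor x)%:~R + b%:R.
  by rewrite /frac_part; ring.
have neq1 (y : R) : (y + 1 == y) = false.
  by rewrite -subr_eq0 addrAC subrr add0r oner_eq0.
rewrite /qp_law; case: ifPn => xint.
  have fx : (Num.floor x)%:~R = x by rewrite floorK.
  rewrite /frac_part fx subrr subr0.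
  by case: b; rewrite ?addr0 ?neq1 ?eqxx.
rewrite ceil_floor xint intrD /frac_part.
by case: b; rewrite ?addr0 /= ?neq1 eqxx //; ring.
Qed.

End Quantizer.

(** * Joint law of state, quantized state and edge *)

Section Gossip.
Context (d : measure_display) (T : measurableType d) (R : realType).
Variable P : probability T R.

Lemma cond_probT (A : set T) : cond_prob P setT A = fine (P A).
Proof. by rewrite /cond_prob setIT probability_setT divr1. Qed.

Lemma cond_probM (C A : set T) : P C != 0%E -> measurable C ->
  fine (P (A `&` C)) = cond_prob P C A * fine (P C).
Proof.
move=> PC mC; rewrite /cond_prob divfK //.
by rewrite fine_eq0 // fin_num_measure.
Qed.

Section Process.
Variables (N : nat) (adj : rel 'I_N) (W : 'M[R]_N) (x0 : 'cV[R]_N).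
Variables (e : nat -> T -> {set 'I_N}) (X Q : nat -> 'I_N -> {RV P >-> R}).
Hypothesis gossip : compensating_gossip adj W x0 e X Q.

Lemma vec_preimage (Y : 'I_N -> {RV P >-> R}) (v : 'cV[R]_N) :
  vec Y @^-1` [set v] = \bigcap_(i in [set: 'I_N]) Y i @^-1` [set v i 0].
Proof.
apply/seteqP; split => [w /= <- i _ /=|w Yv /=]; first by rewrite mxE.
by apply/colP => i; rewrite mxE; apply: Yv.
Qed.

Lemma measurable_preimage1 (Y : {RV P >-> R}) (r : R) :
  measurable (Y @^-1` [set r]).
Proof. by rewrite -[_ @^-1` _]setTI; exact: measurable_funP. Qed.

Lemma measurable_vec_preimage (Y : 'I_N -> {RV P >-> R}) (v : 'cV[R]_N) :
  measurable (vec Y @^-1` [set v]).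
Proof.
by rewrite vec_preimage; apply: fin_bigcap_measurable.
Qed.

Lemma probability_neq0_subset (A B : set T) : measurable A -> measurable B ->
  A `<=` B -> P A != 0%E -> P B != 0%E.
Proof.
move=> mA mB AB; apply: contra_neq => PB0; apply/eqP.
by rewrite -measure_le0 -PB0 le_measure ?inE.
Qed.

(** The law of [Q t i] is given conditionally on [X t i] alone; its independence from the other
    coordinates extends it to conditioning on the whole state. *)
Lemma quantizer_law_vec t v i r :
  let C := vec (X t) @^-1` [set v] in P C != 0%E ->
  cond_prob P C (Q t i @^-1` [set r]) = qp_law (v i 0) r.
Proof.
move=> C PC; pose C1 := X t i @^-1` [set v i 0].
pose C2 := (fun w => row' i (vec (X t) w)) @^-1` [set row' i v].
have mC : measurable C by exact: measurable_vec_preimage.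
have mC1 : measurable C1 by exact: measurable_preimage1.
have CE : C = C2 `&` C1.
  apply/seteqP; split => w; rewrite /C /C1 /C2 /=; first by move=> <-; rewrite mxE.
  move=> [w2 w1]; apply/colP => k; have [->|ki] := eqVneq k i; first by rewrite mxE w1.
  rewrite eq_sym in ki; have [j -> _] := unlift_some ki.
  by have /matrixP/(_ j 0) := w2; rewrite !mxE.
have PC1 : P C1 != 0%E.
  by apply: probability_neq0_subset PC => //; rewrite CE; exact: subIsetr.
have PCf : fine (P C) != 0 by rewrite fine_eq0 // fin_num_measure.
have PC1f : fine (P C1) != 0 by rewrite fine_eq0 // fin_num_measure.
have := quantizer_indep_others gossip PC1 r (row' i v).
rewrite (quantizer_law gossip PC1) /cond_prob -/C2 -setIA -/C1 -CE.
move/(congr1 (fun z => z * fine (P C1))); rewrite mulrA !divfK // => ->.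
by rewrite mulfK.
Qed.

Lemma state_quantizer_law t v q :
  fine (P (vec (X t) @^-1` [set v] `&` vec (Q t) @^-1` [set q])) =
  point_mass P (vec (X t)) v * \prod_i qp_law (v i 0) (q i 0).
Proof.
rewrite setIC /point_mass; set C := vec (X t) @^-1` [set v].
have mC : measurable C by exact: measurable_vec_preimage.
have [PC|PC] := eqVneq (P C) 0%E.
  rewrite PC mul0r (_ : P _ = 0%E) //; apply: (subset_measure0 _ _ _ PC) => //.
  by apply: measurableI => //; exact: measurable_vec_preimage.
rewrite cond_probM // mulrC; congr (_ * _).
have := quantizer_mutual_indep gossip PC [set: 'I_N]%SET (fun i => q i 0).
rewrite (vec_preimage (Q t)) -/C (_ : [set` [set: 'I_N]%SET] = [set: 'I_N]); last first.
  by apply/seteqP; split => // i _ /=; rewrite inE.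
move=> ->; rewrite big_mkcond; apply: eq_bigr => i _.
by rewrite inE (quantizer_law_vec _ _ PC).
Qed.

(** Time 0 serves as reference, since the edge law does not depend on time: [W] fixes it on edges
    and it vanishes elsewhere. *)
Definition edge_weight (s : {set 'I_N}) : R := point_mass P (e 0%N) s.

Lemma edge_law_stationary t s : point_mass P (e t) s = edge_weight s.
Proof.
have notedge u : s \notin edges adj -> point_mass P (e u) s = 0.
  move=> sE; rewrite /point_mass (_ : _ @^-1` _ = set0) ?measure0 //.
  apply/seteqP; split => // w /= ews; move: (edge_in gossip u w).
  by rewrite ews (negbTE sE).
rewrite /edge_weight; have [/imsetP[[i j]]|sE] := boolP (s \in edges adj).
  by rewrite inE /= => ij ->; rewrite /point_mass !(edge_law gossip) //=.
by rewrite !notedge.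
Qed.

Lemma edge_weight_ge0 s : 0 <= edge_weight s.
Proof. exact: fine_ge0. Qed.

Lemma edge_weight_sum1 : \sum_s edge_weight s = 1.
Proof.
apply: EFin_inj; rewrite -sumEFin.
rewrite -(probability_setT P).
transitivity (\sum_(s <- index_enum {set 'I_N}) \int[P]_(x in e 0%N @^-1` [set s]) 1)%E.
  apply: eq_bigr => s _; rewrite integral_cst ?mul1e ?probability_fineK //;
  exact: (edge_measurable gossip).
rewrite -ge0_integral_bigsetU ?index_enum_uniq //; last 2 first.
- exact: (edge_measurable gossip).
- by move=> s s' _ _ [w [/= -> ->]].
rewrite (_ : \big[setU/set0]_(i <- _) _ = setT) ?integral_cst ?mul1e //.
apply/seteqP; split => // w _; rewrite -bigcup_seq; exists (e 0%N w) => //=.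
exact: mem_index_enum.
Qed.

Lemma edge_weight_gt0 : (forall i j, adj i j -> 0 < W i j) ->
  forall i j, adj i j -> 0 < edge_weight [set i; j].
Proof.
by move=> W0 i j ij; rewrite /edge_weight /point_mass (edge_law gossip) //=; apply: W0.
Qed.

Lemma update_centering : irreflexive adj -> forall t w,
  vec (X t.+1) w = vec (X t) w - centering R (e t w) *m vec (Q t) w.
Proof.
move=> adj_irr t w; have /imsetP[[i j]] := edge_in gossip t w.
rewrite inE /= => ij ew.
have ij' : i != j by apply: contraTneq ij => ->; rewrite adj_irr.
have [Xi Xj Xh] := update gossip ij' ew.
apply/colP => k; rewrite [RHS]mxE [X in _ + X]mxE centering_mulE ew cards2 ij'.
rewrite (big_setU1 _ (_ : i \notin [set j]%SET)) ?inE ?ij' ?big_set1 ?mxE //.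
have [->|ki] := eqVneq k i; first by rewrite Xi /=; field.
have [->|kj] := eqVneq k j; first by rewrite Xj /=; field.
by rewrite Xh //= mul0r subr0.
Qed.

(** * Propagation of second moments *)

Hypothesis adj_irr : irreflexive adj.

Local Notation dual := (gossip_dual edge_weight).

(** A finite support [S] of the state at time [t] yields one at the next time: the images of all
    combinations of an edge, a state and a rounding pattern. Averaging over patterns gives the noise
    bound; averaging over edges gives the dual and the trace difference. *)
Lemma second_moment_step t (S : seq 'cV[R]_N) : uniq S ->
  \sum_(v <- S) point_mass P (vec (X t)) v = 1 ->
  exists S' : seq 'cV[R]_N, [/\ uniq S',
    \sum_(v <- S') point_mass P (vec (X t.+1)) v = 1 &
    forall F : 'M[R]_N, psd F ->
      \sum_(v <- S') point_mass P (vec (X t.+1)) v * qform F v <=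
      \sum_(v <- S) point_mass P (vec (X t)) v * qform (dual F) v
        + 4^-1 * (\tr F - \tr (dual F))].
Proof.
move=> S_uniq S_full.
pose a (v : 'cV[R]_N) k := frac_part (v k 0).
(* [q v eps] is the floor of [v] plus [eps]. At an integer coordinate, rounding up gives a spurious
   value, but its weight is 0. *)
pose q v (eps : {ffun 'I_N -> bool}) := v + rounding_noise (a v) eps.
pose Y w := (e t w, (vec (X t) w, vec (Q t) w)).
pose SY := [seq (s, vq) | s <- index_enum {set 'I_N},
  vq <- [seq (v, q v eps) | v <- S, eps <- index_enum {ffun 'I_N -> bool}]].
have Ypre s v r : Y @^-1` [set (s, (v, r))] =
    e t @^-1` [set s] `&` (vec (X t) @^-1` [set v] `&` vec (Q t) @^-1` [set r]).
  by apply/seteqP; split => w; rewrite /Y /=; [case=> -> -> ->|case=> -> [-> ->]].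
have mY u : measurable (Y @^-1` [set u]).
  case: u => s [v r]; rewrite Ypre; apply: measurableI.
    exact: (edge_measurable gossip).
  by apply: measurableI; exact: measurable_vec_preimage.
have massY s v eps : point_mass P Y (s, (v, q v eps)) =
    edge_weight s * (point_mass P (vec (X t)) v * rounding_weight (a v) eps).
  have := edge_indep_state gossip t s (v, q v eps); rewrite !cond_probT /=.
  rewrite -(edge_law_stationary t) /point_mass Ypre => indep.
  transitivity (fine (P (e t @^-1` [set s])) *
    fine (P (vec (X t) @^-1` [set v] `&` vec (Q t) @^-1` [set q v eps]))).
    have -> : vec (X t) @^-1` [set v] `&` vec (Q t) @^-1` [set q v eps] =
        (fun w => (vec (X t) w, vec (Q t) w)) @^-1` [set (v, q v eps)].
      by apply/seteqP; split => w /=; [case=> -> ->|case=> -> ->].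
    exact: indep.
  rewrite state_quantizer_law; congr (_ * (_ * _)); apply: eq_bigr => i _.
  by rewrite !mxE qp_law_round.
have sumY (g : {set 'I_N} * ('cV[R]_N * 'cV[R]_N) -> R) :
    \sum_(u <- SY) point_mass P Y u * g u =
    \sum_s edge_weight s * \sum_(v <- S) point_mass P (vec (X t)) v *
      \sum_eps rounding_weight (a v) eps * g (s, (v, q v eps)).
  rewrite /SY big_allpairs_dep; apply: eq_bigr => s _ /=.
  rewrite big_allpairs_dep mulr_sumr; apply: eq_bigr => v _ /=.
  rewrite !mulr_sumr; apply: eq_bigr => eps _.
  by rewrite massY !mulrA.
have SY_uniq : uniq SY.
  apply: allpairs_uniq; [exact: index_enum_uniq| |by move=> [? ?] [? ?] _ _ /= [-> ->]].
  apply: allpairs_uniq => //; first exact: index_enum_uniq.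
  move=> [v eps] [v' eps'] _ _ /= [<- /addrI/colP epsE]; congr pair.
  apply/ffunP => k; have := epsE k; rewrite !mxE => /addIr/eqP.
  by rewrite eqr_nat; case: (eps k); case: (eps' k).
have SY_full : \sum_(u <- SY) point_mass P Y u = 1.
  under eq_bigr do rewrite -[point_mass _ _ _]mulr1.
  rewrite (sumY (fun=> 1)) /= -[RHS]edge_weight_sum1; apply: eq_bigr => s _.
  rewrite -[RHS]mulr1; congr (_ * _); rewrite -[RHS]S_full; apply: eq_bigr => v _.
  by under eq_bigr do rewrite mulr1; rewrite rounding_weight_sum1 mulr1.
pose step (u : {set 'I_N} * ('cV[R]_N * 'cV[R]_N)) := u.2.1 - centering R u.1 *m u.2.2.
have stepE w : vec (X t.+1) w = step (Y w) by rewrite (update_centering adj_irr).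
have mX := measurable_vec_preimage (X t.+1).
exists (undup (map step SY)); split; first exact: undup_uniq.
  exact: (image_finite_law mY SY_uniq SY_full mX stepE).
move=> F F0; rewrite (sum_point_mass_image mY SY_uniq SY_full mX stepE) sumY.
under [X in _ <= X + _]eq_bigr do rewrite qform_gossip_dual mulr_sumr.
rewrite exchange_big (trace_gossip_dual edge_weight_sum1) mulr_sumr -big_split /=.
apply: ler_sum => s _.
under [X in _ <= X + _]eq_bigr do rewrite mulrCA.
rewrite -mulr_sumr mulrCA -mulrDr ler_wpM2l ?edge_weight_ge0 //.
set D := centering R s.
(* The total mass 1 spreads the noise term over the support, so that the comparison can be made
   state by state. *)
rewrite -[X in _ <= _ + X]mul1r -[X in _ <= _ + X * _]S_full mulr_suml -big_split /=.
apply: ler_sum => v _; rewrite -mulrDr ler_wpM2l ?fine_ge0 //.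
have stepq eps : step (s, (v, q v eps)) =
    (1%:M - D) *m v - D *m rounding_noise (a v) eps.
  by rewrite /step /q /= mulmxDr mulmxBl mul1mx opprD addrA.
under eq_bigr do rewrite stepq.
by apply: qform_rounding_noise => // k; exact: frac_part_itv.
Qed.

(** The induction hypothesis is used at [dual F], which is why [F] is quantified after [S]; the
    trace differences then telescope. *)
Lemma second_moment_bound t : exists S : seq 'cV[R]_N, [/\ uniq S,
    \sum_(v <- S) point_mass P (vec (X t)) v = 1 &
    forall F : 'M[R]_N, psd F ->
      \sum_(v <- S) point_mass P (vec (X t)) v * qform F v <=
      qform (iter t dual F) x0 + 4^-1 * (\tr F - \tr (iter t dual F))].
Proof.
elim: t => [|t [S [S_uniq S_full SP]]].
  exists [:: x0]; have mass1 : point_mass P (vec (X 0%N)) x0 = 1.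
    rewrite /point_mass (_ : _ @^-1` _ = setT) ?probability_setT //.
    by apply/seteqP; split => // w _; exact: init gossip w.
  split => //; first by rewrite big_seq1.
  by move=> F _; rewrite big_seq1 mass1 mul1r subrr mulr0 addr0.
have [S' [S'_uniq S'_full S'P]] := second_moment_step S_uniq S_full.
exists S'; split => // F F0.
apply: le_trans (S'P F F0) _.
have := SP _ (psd_gossip_dual edge_weight_ge0 F0).
rewrite -iterSr; lra.
Qed.

Lemma sqr_enorm_disagreement (x : 'cV[R]_N) :
  enorm (disagreement x) ^+ 2 = qform (centering R [set: 'I_N]) x.
Proof.
rewrite /enorm sqr_sqrtr; last by apply: sumr_ge0 => k _; exact: sqr_ge0.
rewrite qform_centering; apply: eq_bigr => k _; congr (_ ^+ 2).
rewrite /disagreement; congr ((_ *m _) k 0); apply/matrixP => i j.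
by rewrite !mxE big_ord1 !mxE !inE cardsT card_ord !mul1r mulr1.
Qed.

Lemma measurable_qform_vec (F : 'M[R]_N) t :
  measurable_fun setT (fun w => qform F (vec (X t) w)).
Proof.
under eq_fun do rewrite qformE.
apply: measurable_sum => k; apply: measurable_sum => l.
apply: measurable_funM => //.
by under eq_fun do rewrite !mxE; apply: measurable_funM.
Qed.

Lemma expectation_disagreement_le t :
  ('E_P[(fun w => enorm (disagreement (vec (X t) w)) ^+ 2)%R] <=
  (qform (iter t dual (centering R [set: 'I_N])) x0 + 4^-1 * N%:R)%:E)%E.
Proof.
have [S [S_uniq S_full SP]] := second_moment_bound t.
set O := centering R [set: 'I_N].
rewrite unlock; under eq_integral do rewrite sqr_enorm_disagreement -/O.
have mX := measurable_vec_preimage (X t).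
rewrite (integral_finite_law mX S_uniq S_full); last 2 first.
- exact/measurable_EFinP/measurable_qform_vec.
- by move=> w; rewrite lee_fin psd_centering.
rewrite (eq_bigr (fun v => (point_mass P (vec (X t)) v * qform O v)%:E)); last first.
  move=> v _; rewrite (eq_integral (cst (qform O v)%:E)) => [|w]; last first.
    by rewrite inE /= => ->.
  by rewrite integral_cst // mulrC EFinM probability_fineK.
rewrite sumEFin lee_fin; apply: le_trans (SP _ (@psd_centering _ _ _)) _.
rewrite lerD2l ler_wpM2l // lerBlDr.
apply: le_trans (@trace_centeringT_le _ _) _.
rewrite lerDl psd_trace_ge0 //; elim: t {S S_uniq S_full SP mX} => [|t IHt].
  exact: psd_centering.
by apply: psd_gossip_dual => // s; exact: edge_weight_ge0.
Qed.

End Process.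
End Gossip.

(** * Asymptotic performance bound *)

Theorem corollary3p7 (R : realType) (N : nat) (adj : rel 'I_N)
    (adj_connected : connected_graph adj)
    (W : 'M[R]_N) (W_selection : selection_matrix adj W)
    (d : measure_display) (T : measurableType d) (P : probability T R)
    (x0 : 'cV[R]_N) (e : nat -> T -> {set 'I_N})
    (X Q : nat -> 'I_N -> {RV P >-> R})
    (gossip : compensating_gossip adj W x0 e X Q) :
  (performance X <= (2^-1)%:E)%E.
Proof.
have [_ adj_irr _] := adj_connected.
have [_ W_gt0 _ _] := W_selection.
have [r /andP[r0 r1] contraction] := gossip_dual_contraction (edge_weight_ge0 P e)
  (edge_weight_sum1 gossip) adj_connected (edge_weight_gt0 gossip W_gt0).
set O := centering R [set: 'I_N] in contraction.
pose c := N%:R^-1 * qform O x0.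
have c0 : 0 <= c by rewrite mulr_ge0 ?invr_ge0 // psd_centering.
(* The normalized second moment is at most 1/4 + u with u = [c * r ^+ t], hence at most (1/2 +
   u)^2. *)
have bound t : (sqrte ((N%:R^-1)%:E *
      'E_P[(fun w => enorm (disagreement (vec (X t) w)) ^+ 2)%R]) <=
    (2^-1 + c * r ^+ t)%:E)%E.
  have cr0 : 0 <= c * r ^+ t by rewrite mulr_ge0 ?exprn_ge0.
  have h0 : 0 <= 2^-1 + c * r ^+ t by rewrite addr_ge0.
  have -> : (2^-1 + c * r ^+ t)%:E = sqrte (((2^-1 + c * r ^+ t) ^+ 2)%:E).
    by rewrite /= sqrtr_sqr ger0_norm.
  rewrite lee_sqrt ?lee_fin ?sqr_ge0 //.
  apply: le_trans (lee_wpmul2l _ (expectation_disagreement_le gossip adj_irr t)) _.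
    by rewrite lee_fin invr_ge0.
  rewrite -EFinM lee_fin mulrDr.
  (* Only an inequality, since the left side is 0 when [N] is 0. *)
  have : N%:R^-1 * (4^-1 * N%:R) <= 4^-1 :> R.
    rewrite mulrCA ler_piMr //.
    by have [->|N0] := eqVneq N 0%N; rewrite ?mulr0 // mulVf // pnatr_eq0.
  have : N%:R^-1 * qform (iter t (gossip_dual (edge_weight P e)) O) x0 <= c * r ^+ t.
    by rewrite /c -mulrA ler_wpM2l ?invr_ge0 // mulrC contraction.
  have := sqr_ge0 (c * r ^+ t); rewrite sqrrD; lra.
have cvg0 : (c * r ^+ t @[t --> \oo] --> 0).
  by apply: cvg_geometric; rewrite ger0_norm.
apply/lee_addgt0Pr => eps eps0; rewrite /performance /limn_esup limf_esupE.
have /cvgrPdist_lt/(_ _ eps0) small := cvg0.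
(* The limit superior is an infimum of suprema over sets of the filter at infinity; the times with
   [c * r ^+ t] below [eps] form such a set. *)
apply: ge_ereal_inf; exists (ereal_sup [set sqrte ((N%:R^-1)%:E *
    'E_P[(fun w => enorm (disagreement (vec (X t) w)) ^+ 2)%R])%E |
    t in [set t | `|0 - c * r ^+ t| < eps]]).
  by exists [set t | `|0 - c * r ^+ t| < eps].
apply: ge_ereal_sup => _ [t /= small_t <-].
apply: le_trans (bound t) _.
rewrite -EFinD lee_fin lerD2l.
by move: small_t; rewrite sub0r normrN => /ltW; apply: le_trans; exact: ler_norm.
Qed.
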